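(* Let $B$ be a Banach space, $D$ a nonempty closed convex subset of $B$, and $T:D\to D$ a contraction, i.e. there is $\delta\in(0,1)$ such that $\|Tx-Ty\|\le\delta\|x-y\|$ for all $x,y\in D$. Let $\{\eta_n^1\}_{n=0}^\infty$ and $\{\eta_n^2\}_{n=0}^\infty$ be real sequences in $[0,1]$ satisfying $\sum_{k=0}^{\infty}\eta_k^1\eta_k^2=\infty$. Let $x_0\in D$ and let $\{x_n\}_{n=0}^\infty$ be the Picard-S iterative sequence generated by $$x_{n+1}=Ty_n,\qquad y_n=(1-\eta_n^1)Tx_n+\eta_n^1Tz_n,\qquad z_n=(1-\eta_n^2)x_n+\eta_n^2Tx_n,\qquad n\in\mathbb{N}.$$ Then $T$ has a unique fixed point $x_*$ in $D$, and $\{x_n\}_{n=0}^\infty$ converges (in norm) to $x_*$.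
   Context: $\mathbb{N}$ denotes the set of nonnegative integers $\{0,1,2,\dots\}$. The superscripts in $\eta_n^1,\eta_n^2$ are indices, not powers. *)

(* Defs.v *)
From mathcomp Require Export all_boot all_order all_algebra.
From mathcomp Require Export all_classical all_reals all_analysis.
Export Order.TTheory GRing.Theory Num.Theory.
Export numFieldNormedType.Exports.

Set Implicit Arguments.
Unset Strict Implicit.
Unset Printing Implicit Defensive.

(* Main.v *)
Require Import Defs.

(** If [p] is the fixed point then [z n] and [T (z n)] are at distance at most
    [`|x n - p|] and [delta * `|x n - p|] from [p], so [y n], a convex combination
    of [T (x n)] and [T (z n)], satisfies [`|y n - p| <= delta * `|x n - p|].  Hence
    [`|x n.+1 - p| <= delta ^+ 2 * `|x n - p|]. *)

Local Open Scope classical_set_scope.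
Local Open Scope ring_scope.

Lemma convex_set_comb (R : realType) (V : lmodType R) (A : set V)
    (a b : V) (t : R) :
  convex_set A -> 0 <= t <= 1 -> A a -> A b -> A ((1 - t) *: a + t *: b).
Proof.
(* [convex_set] puts the weight [t] on its first point, hence the swap of the summands. *)
move=> cA /andP[t0 t1] Aa Ab; rewrite addrC.
by have := cA b a (Itv01 t0 t1); rewrite !inE; apply.
Qed.

(** Closed balls are convex: splitting [p] with the same weights reduces this to the triangle
    inequality. *)
Lemma dist_comb_le (R : realType) (V : normedModType R) (a b p : V) (t r : R) :
  0 <= t <= 1 -> `|a - p| <= r -> `|b - p| <= r ->
  `|(1 - t) *: a + t *: b - p| <= r.
Proof.
move=> /andP[t0 t1] ar br.
have -> : (1 - t) *: a + t *: b - p = (1 - t) *: (a - p) + t *: (b - p).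
  by rewrite !scalerBr addrACA -opprD -scalerDl subrK scale1r.
rewrite (le_trans (ler_normD _ _))// !normrZ (ger0_norm t0) ger0_norm ?subr_ge0//.
rewrite -[leRHS]mul1r -[in leRHS](subrK t 1) [leRHS]mulrDl.
by rewrite lerD// ler_wpM2l// subr_ge0.
Qed.

(** By induction the distances to [p] lie below a geometric sequence of ratio [q], so they are
    squeezed to 0. *)
Lemma cvg_dist_geometric (R : realType) (V : normedModType R) (u : V^nat)
    (p : V) (q : R) :
  0 <= q < 1 -> (forall n, `|u n.+1 - p| <= q * `|u n - p|) -> u @ \oo --> p.
Proof.
move=> /andP[q0 q1] uS; apply/subr_cvg0; apply: norm_cvg0.
have un n : `|u n - p| <= geometric `|u 0%N - p| q n.
  elim: n => [|n ih] /=; first by rewrite expr0 mulr1.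
  by rewrite (le_trans (uS n))// exprS mulrCA ler_wpM2l.
have un0 : \forall n \near \oo,
    0 <= `|u n - p| <= geometric `|u 0%N - p| q n.
  by apply: nearW => n; rewrite normr_ge0 un.
apply: (squeeze_cvgr un0); first exact: cvg_cst.
by apply: cvg_geometric; rewrite ger0_norm.
Qed.

Theorem theorem1 (R : realType) (B : completeNormedModType R) (D : set B)
    (D_nonempty : D !=set0) (D_closed : closed D) (D_convex : convex_set D)
    (T : {fun D >-> D}) (delta : R) (delta01 : 0 < delta < 1)
    (T_contraction : delta.-lipschitz_D T)
    (eta1 eta2 : R^nat)
    (eta1_01 : forall n, 0 <= eta1 n <= 1)
    (eta2_01 : forall n, 0 <= eta2 n <= 1)
    (eta_sum : (\sum_(0 <= k <oo) (eta1 k * eta2 k)%:E = +oo)%E)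
    (x y z : B^nat) (x0_D : D (x 0%N))
    (x_rec : forall n, x n.+1 = T (y n))
    (y_def : forall n,
      y n = (1 - eta1 n) *: T (x n) + eta1 n *: T (z n))
    (z_def : forall n,
      z n = (1 - eta2 n) *: x n + eta2 n *: T (x n)) :
  exists xs : B,
    [/\ D xs /\ T xs = xs,
        forall q : B, D q /\ T q = q -> q = xs
      & x @ \oo --> xs].
Proof.
have /andP[delta0 delta1] := delta01.
have T_ctr : is_contraction T by exists (NngNum (ltW delta0)).
have [p Dp Tp] := banach_fixed_point T_ctr D_closed D_nonempty.
have TD a : D a -> D (T a) by move=> Da; exact: funS.
have T_dist a : D a -> `|T a - p| <= delta * `|a - p|.
  (* Only the [p] on the left-hand side becomes [T p]. *)
  by move=> Da; rewrite {1}Tp; exact: (T_contraction (a, p)).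
(* The Lipschitz bound holds only on [D], so all iterates must be shown to stay there. Membership of
   [z n] and [y n] is conditional on that of [x n], to feed the induction in [xD]. *)
have zD n : D (x n) -> D (z n).
  by move=> Dx; rewrite z_def; apply: convex_set_comb => //; exact: TD.
have yD n : D (x n) -> D (y n).
  by move=> Dx; rewrite y_def; apply: convex_set_comb => //; apply: TD => //; exact: zD.
have xD n : D (x n) by elim: n => // n Dx; rewrite x_rec; exact/TD/yD.
have z_dist n : `|z n - p| <= `|x n - p|.
  rewrite z_def dist_comb_le// (le_trans (T_dist _ (xD n)))//.
  by rewrite ler_piMl// ltW.
have y_dist n : `|y n - p| <= delta * `|x n - p|.
  rewrite y_def dist_comb_le//; first exact: T_dist.
  by rewrite (le_trans (T_dist _ (zD _ (xD n))))// ler_pM2l.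
exists p; split => //.
  by move=> q [Dq Tq]; apply: (contraction_fixpoint_unique T_ctr).
(* One factor [delta] comes from the outer [T] in [x_rec], the other from [y_dist]. *)
apply: (@cvg_dist_geometric _ _ _ _ (delta ^+ 2)).
  by rewrite exprn_ge0 ?ltW//= exprn_ilt1// ltW.
move=> n; rewrite x_rec (le_trans (T_dist _ (yD _ (xD n))))//.
by rewrite expr2 -mulrA ler_pM2l.
Qed.
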